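(* It holds that $$b_n=\overline{\beta}_n+O\left(\frac{(\log\log n)^2}{(\log n)^{5/2}}\right),\quad n\to\infty,$$ where $$\overline{\beta}_n=\left(\log\bigl(n^2/(2\pi)\bigr)-\log\log\bigl(n^2/(2\pi)\bigr)+\frac{\log\log\bigl(n^2/(2\pi)\bigr)-2}{\log\bigl(n^2/(2\pi)\bigr)}\right)^{1/2}.$$
   Context: $\Phi$ is the distribution function of the standard normal law and $b_n=\Phi^{-1}(1-\frac1n)$. Here $\log$ is the natural logarithm. *)

(* Defs.v *)
From mathcomp Require Import all_boot all_order all_algebra.
From mathcomp Require Import all_classical all_reals all_analysis.
Import Order.TTheory GRing.Theory Num.Theory numFieldNormedType.Exports.

Set Implicit Arguments.
Unset Strict Implicit.
Unset Printing Implicit Defensive.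

Local Open Scope classical_set_scope.
Local Open Scope ring_scope.

Definition std_normal_cdf (R : realType) (x : R) : R :=
  fine (normal_prob (0 : R) 1 `]-oo, x]).

(* Only meaningful on the range ]0, 1[ of the cdf; [pinv] takes a default
   value elsewhere. *)
Definition std_normal_quantile (R : realType) : R -> R :=
  pinv [set: R] (@std_normal_cdf R).

(* For n <= 1 this is a junk value, which is invisible to asymptotics at \oo;
   the same holds for the small n at which [beta_bar] applies [ln] or
   [Num.sqrt] outside their domains. *)
Definition b_ (R : realType) (n : nat) : R :=
  std_normal_quantile (1 - n%:R^-1).

Definition beta_bar (R : realType) (n : nat) : R :=
  let L := ln (n%:R ^+ 2 / (2 * pi)) in
  Num.sqrt (L - ln L + (ln L - 2) / L).

(* Main.v *)
Require Import Defs.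
From HB Require Import structures.
From mathcomp Require Import all_boot all_order all_algebra.
From mathcomp Require Import ring lra.
From mathcomp Require Import all_classical all_reals all_analysis.
From mathcomp Require Import measurable_realfun.
Import Order.TTheory GRing.Theory Num.Theory numFieldNormedType.Exports.

Local Open Scope classical_set_scope.
Local Open Scope ring_scope.

(** Write y = b_n^2 and L = ln (n^2 / (2 pi)). Since 1 - Phi(b_n) = 1/n, the
Mills ratio expansion
  phi(x) (1/x - 1/x^3) <= 1 - Phi(x) <= phi(x) (1/x - 1/x^3 + 3/x^5)
([std_normal_ccdf_ge], [std_normal_ccdf_le]) yields, after taking logarithms,
an equation for y with an explicit error ([ln_std_normal_ccdf]):
  y + ln y + 2/y + e = L,   |e| <= 6/y^2.
Solving it by substitution gives y = L - ln y - 2/y - e with ln y = ln L +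
O(ln L / L); one more substitution gives
  y = L - ln L + (ln L - 2)/L + O((ln L)^2 / L^2)
([ln_equation_expansion]). The main part is the square of beta_bar n, and
taking square roots divides the error by b_n, which is of order L^(1/2)
([sqrtr_dist_le]). Finally L is comparable to ln n ([b_error_bound]).

Both Mills bounds come from integrating exactly a density that lies on one side
of phi: the derivatives of phi(t)/t^k combine so that phi(t) (1 - 3/t^4) and
phi(t) (1 + 15/t^6) have elementary primitives.

That b_n is a genuine quantile, Phi(b_n) = 1 - 1/n, follows from the
intermediate value theorem, Phi being Lipschitz with limits 0 and 1
([std_normal_quantileK]). *)

(** * Solving y + ln y + 2/y = L asymptotically *)

Lemma ln_le_subr1 (R : realType) (x : R) : 0 < x -> ln x <= x - 1.
Proof.
by move=> x0; rewrite -[in leLHS](subrK 1 x) addrC le_ln1Dx//; lra.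
Qed.

(** The lower bound is [ln x <= x - 1] at x = 1 / (1 - u). *)
Lemma ln_onemB_bounds (R : realType) (u : R) : 0 <= u <= 2^-1 ->
  - u - 2 * u ^+ 2 <= ln (1 - u) <= - u.
Proof.
move=> u01; apply/andP; split; last by apply: le_ln1Dx; lra.
have v0 : 0 < 1 - u by lra.
have : ln ((1 - u)^-1) <= (1 - u)^-1 - 1 by rewrite ln_le_subr1// invr_gt0.
rewrite lnV ?posrE// => h.
have : (1 - u)^-1 <= 1 + u + 2 * u ^+ 2; last lra.
rewrite -div1r ler_pdivrMr//; nra.
Qed.

(** Equivalent to e <= 4, which follows from exp(-1/2) >= 1 - 1/2. *)
Lemma ln_ge1 (R : realType) (x : R) : 4 <= x -> 1 <= ln x.
Proof.
move=> x4; rewrite -ler_expR lnK ?posrE; last lra.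
have h : 1 + - 2^-1 <= expR (- 2^-1 : R) by exact: expR_ge1Dx.
have E : expR (- 2^-1 : R) ^+ 2 * expR 1 = 1.
  by rewrite -expRM_natr -expRD -[RHS]expR0; congr expR; field.
have h2 : 4^-1 <= expR (- 2^-1 : R) ^+ 2 by nra.
have := expR_gt0 (1 : R); nra.
Qed.

(** Let d = L - y and u = d / L, so that ln y = ln L + ln (1 - u), which is
ln L - u up to 2 u^2. Since d = ln y + 2/y + e is ln L + O(ln L / L), the
correction u is ln L / L + O(ln L / L^2); replacing moreover 2/y by 2/L costs
2 d / (y L). The four contributions to the constant 50 are 10, 8, 8 and 24. *)
Lemma ln_equation_expansion (R : realType) (y L e : R) :
  16 <= y -> y + ln y + 2 / y + e = L -> `|e| <= 6 / y ^+ 2 ->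
  [/\ 16 <= L, L <= 2 * y, 0 <= L - ln L + (ln L - 2) / L &
   `|y - (L - ln L + (ln L - 2) / L)| <= 50 * (ln L / L) ^+ 2].
Proof.
move=> y16 yL; rewrite ler_norml => /andP[e1 e2].
have y0 : 0 < y by lra.
have ly1 : 1 <= ln y by apply: ln_ge1; lra.
have lny := ln_le_subr1 _ _ y0.
rewrite -exprVn in e1 e2.
set i := y^-1 in yL e1 e2 *.
have i0 : 0 < i by rewrite invr_gt0.
have yi : y * i = 1 by rewrite divff// gt_eqF.
have i16 : 16 * i <= 1 by nra.
have i2 : 16 * i ^+ 2 <= i by nra.
have yleL : y <= L by nra.
have L2y : L <= 2 * y by nra.
have L16 : 16 <= L by lra.
have L0 : 0 < L by lra.
have lnL := ln_le_subr1 _ _ L0.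
have mlel : ln y <= ln L by rewrite ler_ln ?posrE.
set l := ln L in lnL mlel *; set j := L^-1.
have Lj : L * j = 1 by rewrite divff// gt_eqF.
have j0 : 0 < j by rewrite invr_gt0.
have j16 : 16 * j <= 1 by nra.
set d := L - y.
have d0 : 0 <= d by rewrite /d; lra.
have dL : d <= 2^-1 * L by rewrite /d; lra.
have dl : d <= 2 * l by rewrite /d; nra.
set u := d * j.
have u01 : 0 <= u <= 2^-1 by rewrite /u; apply/andP; split; nra.
have lny' : ln y = l + ln (1 - u).
  rewrite /l -lnM ?posrE//; last lra.
  by congr ln; rewrite /u /d mulrBr mulr1 mulrCA Lj; ring.
have := ln_onemB_bounds _ _ u01.
rewrite -(addKr l (ln (1 - u))) -lny' => /andP[m1 m2].
case/andP: u01 => u0 u2.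
set m := ln y in ly1 lny mlel lny' m1 m2 yL *.
set p := l * j.
have l1 : 1 <= l by lra.
have jp : j <= p by rewrite /p; nra.
have p0 : 0 <= p by lra.
have pj : p * j <= p ^+ 2 by rewrite expr2 ler_wpM2l.
have sq (a b : R) : 0 <= a -> a <= b -> a ^+ 2 <= b ^+ 2.
  by move=> a0 ab; rewrite lerXn2r ?nnegrE//; lra.
have up : u <= 2 * p by rewrite /u /p; nra.
(* From L <= 2 y, after multiplying by i * j. *)
have i2j : i <= 2 * j.
  have -> : i = i * j * L by rewrite -mulrA (mulrC j) Lj mulr1.
  have -> : 2 * j = i * j * (2 * y) by rewrite -[LHS]mulr1 -yi; ring.
  by rewrite ler_wpM2l// mulr_ge0// ltW.
have a1 : `|d - l| <= 10 * p.
  have dE : d = m + 2 * i + e by rewrite /d -yL; ring.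
  have u2u : 2 * u ^+ 2 <= u by nra.
  by rewrite ler_norml dE; apply/andP; split; lra.
have aj : `|(d - l) * j| <= 10 * p ^+ 2.
  rewrite normrM (gtr0_norm j0) expr2.
  by rewrite (le_trans (ler_wpM2r (ltW j0) a1))// -mulrA -expr2; lra.
have ij : i - j = d * i * j.
  by rewrite /d -[i in LHS]mulr1 -Lj -[j in X in _ - X]mul1r -yi; ring.
have ij4 : 0 <= i - j <= 4 * p ^+ 2.
  rewrite ij; apply/andP; split; first by rewrite !mulr_ge0// ltW.
  have : d * i * j <= (2 * l) * (2 * j) * j.
    by rewrite (ler_wpM2r (ltW j0))// ler_pM// (ltW i0).
  have -> : 2 * l * (2 * j) * j = 4 * (p * j) by rewrite /p; ring.
  by lra.
have u2p : u ^+ 2 <= 4 * p ^+ 2.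
  by rewrite (_ : 4 * _ = (2 * p) ^+ 2); [apply: sq|ring].
have i2p : i ^+ 2 <= 4 * p ^+ 2.
  by rewrite (_ : 4 * _ = (2 * p) ^+ 2); [apply: sq; lra|ring].
split=> //; first by rewrite mulrBl -/p; lra.
(* Errors: the quadratic term of the logarithm, d versus ln L, 1/y versus
   1/L, and e. *)
have -> : y - (L - l + (l - 2) * j) = l - m - u + ((d - l) * j) - 2 * (i - j) - e.
  by rewrite /u -yL /d -yL; ring.
rewrite -/p; move: aj; rewrite !ler_norml => /andP[aj1 aj2].
by apply/andP; split; lra.
Qed.

(** * Mills ratio of the normal law *)

Lemma std_normal_pdfE (R : realType) (t : R) :
  normal_pdf 0 1 t = (Num.sqrt (2 * pi))^-1 * expR (- (t ^+ 2 / 2)).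
Proof.
rewrite normal_pdfE ?oner_eq0// /normal_peak /normal_fun subr0 expr1n mul1r.
by rewrite -(mulr_natl pi) mulNr.
Qed.

Lemma std_normal_pdf_gt0 (R : realType) (t : R) : 0 < normal_pdf 0 1 t.
Proof.
rewrite std_normal_pdfE mulr_gt0 ?expR_gt0// invr_gt0 sqrtr_gt0 mulr_gt0//.
exact: pi_gt0.
Qed.

(** The terms of these derivatives cancel in pairs: a suitable combination over
even k has derivative -phi up to one remaining power of 1/t. *)
Lemma is_derive_std_normal_pdf_invX (R : realType) (k : nat) (t : R) : 0 < t ->
  is_derive t 1 (fun x => normal_pdf 0 1 x * x^-1 ^+ k.+1)
    (- (normal_pdf 0 1 t * (t^-1 ^+ k + k.+1%:R * t^-1 ^+ k.+2))).
Proof.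
move=> t0.
have tn0 : t != 0 by rewrite gt_eqF.
have dq : is_derive t 1 (fun x : R => - (x ^+ 2 / 2)) (- t).
  have -> : (fun x : R => - (x ^+ 2 / 2)) = (- 2^-1) \*: (@id R ^+ 2).
    by apply/funext => x; rewrite /= exprfctE /GRing.scale/=; ring.
  apply: is_derive_eq.
  by rewrite /= /GRing.scale/=; field.
have dphi : is_derive t 1 (normal_pdf 0 1 : R -> R) (- (t * normal_pdf 0 1 t)).
  have -> : (normal_pdf 0 1 : R -> R) =
      (Num.sqrt (2 * pi))^-1 \*: (expR \o (fun x => - (x ^+ 2 / 2))).
    by apply/funext => x; rewrite std_normal_pdfE.
  rewrite /=; apply: is_derive_eq.
  by rewrite /= /GRing.scale/=; ring.
have dinv : is_derive t 1 (fun x : R => x^-1) (- t ^- 2 *: 1).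
  exact: is_deriveV.
rewrite (_ : (fun _ => _) = (normal_pdf 0 1 : R -> R) * (fun x : R => x^-1) ^+ k.+1).
  apply: is_derive_eq.
  by rewrite /GRing.scale/= exprfctE -!exprVn !exprS; field.
by apply/funext => x; rewrite /= exprfctE.
Qed.

Lemma cvg_std_normal_pdf_invX (R : realType) (k : nat) :
  (normal_pdf 0 1 x * x^-1 ^+ k.+1 : R) @[x --> +oo] --> (0 : R).
Proof.
apply: (@squeeze_cvgr _ _ _ _ (cst 0) (fun x => normal_peak 1 * x^-1)).
- near=> x.
  have x1 : 1 <= x by near: x; apply: nbhs_pinfty_ge; rewrite num_real.
  have x0 : 0 < x by rewrite (lt_le_trans _ x1).
  have i0 : 0 <= x^-1 by rewrite invr_ge0 ltW.
  have i1 : x^-1 <= 1 by rewrite invf_le1.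
  rewrite mulr_ge0 ?normal_pdf_ge0 ?exprn_ge0//=.
  rewrite ler_pM ?normal_pdf_ge0 ?exprn_ge0//.
    by rewrite normal_pdf_ub// oner_neq0.
  by rewrite exprS ler_piMr// exprn_ile1.
- exact: cvg_cst.
- rewrite -[X in _ --> X](mulr0 (normal_peak 1)).
  apply: cvgM; first exact: cvg_cst.
  apply/gtr0_cvgV0; last exact: cvg_id.
  exact: nbhs_pinfty_gt.
Unshelve. all: by end_near. Qed.

(** The fundamental theorem of calculus on a half-line, phrased for F like
phi(t)/t^k: decreasing to 0, so that only the value at [a] contributes. *)
Lemma integral_itvcy_decay (R : realType) (f F : R -> R) (a : R) :
  (forall t, a <= t -> 0 <= f t) ->
  {within `[a, +oo[, continuous f} ->
  (forall t, a <= t -> is_derive t 1 F (- f t)) ->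
  F x @[x --> +oo] --> (0 : R) ->
  (\int[lebesgue_measure]_(x in `[a, +oo[) (f x)%:E = (F a)%:E)%E.
Proof.
move=> f0 cf dF Fy.
have dNF t : a <= t -> is_derive t 1 (- F) (f t).
  by move=> /dF d; rewrite -[f t]opprK; exact: is_deriveN.
rewrite (@ge0_continuous_FTC2y _ _ (- F) _ 0)//.
- by rewrite sub0e -EFinN opprK.
- by rewrite -oppr0; exact: cvgN.
- by move=> x /ltW /dNF.
- apply: cvg_at_right_filter.
  apply/differentiable_continuous/derivable1_diffP.
  by have := dNF a (lexx _).
- move=> x; rewrite in_itv/= andbT => /ltW /dNF d.
  by rewrite derive1E derive_val.
Qed.

Lemma std_normal_ccdfE (R : realType) (a : R) :
  ((1 - std_normal_cdf a)%:E =
   \int[lebesgue_measure]_(x in `[a, +oo[) (normal_pdf 0 1 x)%:E)%E.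
Proof.
rewrite -integral_itv_obnd_cbnd; last first.
  apply/measurable_EFinP; apply: measurable_funTS.
  exact: measurable_normal_pdf.
rewrite EFinB /std_normal_cdf fineK//; last exact: fin_num_measure.
rewrite -probability_setC//.
by rewrite setCitvl.
Qed.

Lemma within_continuous_std_normal_pdf_corrected (R : realType)
    (c a : R) (m : nat) : 0 < a ->
  {within `[a, +oo[,
    continuous (fun t : R => normal_pdf 0 1 t * (1 + c * t^-1 ^+ m))}.
Proof.
move=> a0; apply: continuous_in_subspaceT => t; rewrite inE/= in_itv/= andbT => at_.
apply: cvgM; first by apply: continuous_normal_pdf; rewrite oner_neq0.
apply: cvgD; first exact: cvg_cst.
apply: cvgM; first exact: cvg_cst.
apply: (@continuous_comp _ _ _ (fun x : R => x^-1) (fun x : R => x ^+ m)).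
  by apply: inv_continuous; rewrite gt_eqF// (lt_le_trans a0).
exact: exprn_continuous.
Qed.

(** The density phi(t) (1 - 3/t^4) is below phi, and nonnegative for t >= 2. *)
Lemma std_normal_ccdf_ge (R : realType) (a : R) : 2 <= a ->
  normal_pdf 0 1 a * (a^-1 - a^-1 ^+ 3) <= 1 - std_normal_cdf a.
Proof.
move=> a2.
have a0 : 0 < a by lra.
pose f (t : R) := normal_pdf 0 1 t * (1 + (-3) * t^-1 ^+ 4).
pose I k (t : R) := normal_pdf 0 1 t * t^-1 ^+ k.+1.
have f0 t : a <= t -> 0 <= f t.
  move=> at_; rewrite mulr_ge0 ?normal_pdf_ge0//.
  have t0 : 0 < t by lra.
  have i0 : 0 < t^-1 by rewrite invr_gt0.
  have i2 : t^-1 <= 2^-1 by rewrite lef_pV2 ?posrE//; lra.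
  have : t^-1 ^+ 2 <= 4^-1 by nra.
  have : 0 <= t^-1 ^+ 2 by rewrite sqr_ge0.
  by rewrite (exprM t^-1 2 2); nra.
have cf := @within_continuous_std_normal_pdf_corrected R (-3) a 4 a0.
rewrite -lee_fin std_normal_ccdfE.
pose F := I 0%N - I 2%N.
rewrite (_ : _ * _ = F a); last by rewrite /F /I /= !fctE; ring.
have <- : (\int[lebesgue_measure]_(x in `[a, +oo[) (f x)%:E = (F a)%:E)%E.
  have dI t : a <= t -> is_derive t 1 F (- f t).
    move=> at_; have t0 : 0 < t by lra.
    have d0 := is_derive_std_normal_pdf_invX R 0%N t t0.
    have d2 := is_derive_std_normal_pdf_invX R 2%N t t0.
    by apply: (@is_derive_eq _ _ _ _ _ _ _ _ (is_deriveB d0 d2)); rewrite /f; ring.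
  have c := cvg_std_normal_pdf_invX R.
  have cI := cvgB (c 0%N) (c 2%N); rewrite subr0 in cI.
  exact: (integral_itvcy_decay _ _ _ _ f0 cf dI (cI _)).
apply: ge0_le_integral => //=.
- by move=> t; rewrite in_itv/= andbT lee_fin => /f0.
- apply/measurable_EFinP; exact: subspace_continuous_measurable_fun.
- apply/measurable_EFinP; apply: measurable_funTS; exact: measurable_normal_pdf.
- move=> t; rewrite in_itv/= andbT lee_fin => at_.
  rewrite /f ler_piMr ?normal_pdf_ge0// gerDl mulNr oppr_le0 mulr_ge0// exprn_ge0//.
  by rewrite invr_ge0; lra.
Qed.

(** The density phi(t) (1 + 15/t^6) is above phi. *)
Lemma std_normal_ccdf_le (R : realType) (a : R) : 0 < a ->
  1 - std_normal_cdf a <= normal_pdf 0 1 a * (a^-1 - a^-1 ^+ 3 + 3 * a^-1 ^+ 5).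
Proof.
move=> a0.
pose f (t : R) := normal_pdf 0 1 t * (1 + 15 * t^-1 ^+ 6).
pose I k (t : R) := normal_pdf 0 1 t * t^-1 ^+ k.+1.
have f1 t : a <= t -> normal_pdf 0 1 t <= f t.
  move=> at_; rewrite /f ler_peMr ?normal_pdf_ge0// lerDl mulr_ge0// exprn_ge0//.
  by rewrite invr_ge0; lra.
have f0 t : a <= t -> 0 <= f t.
  by move=> /f1; apply: le_trans; rewrite normal_pdf_ge0.
have cf := @within_continuous_std_normal_pdf_corrected R 15 a 6 a0.
rewrite -lee_fin std_normal_ccdfE.
pose F := I 0%N - I 2%N + cst 3 * I 4%N.
rewrite (_ : _ * _ = F a); last by rewrite /F /I /= !fctE; ring.
have <- : (\int[lebesgue_measure]_(x in `[a, +oo[) (f x)%:E = (F a)%:E)%E.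
  have dI t : a <= t -> is_derive t 1 F (- f t).
    move=> at_; have t0 : 0 < t by lra.
    have d0 := is_derive_std_normal_pdf_invX R 0%N t t0.
    have d2 := is_derive_std_normal_pdf_invX R 2%N t t0.
    have d4 := is_derive_std_normal_pdf_invX R 4%N t t0.
    have d3 := is_deriveM (is_derive_cst (3 : R) t 1) d4.
    apply: (@is_derive_eq _ _ _ _ _ _ _ _ (is_deriveD (is_deriveB d0 d2) d3)).
    by rewrite /f /GRing.scale/=; ring.
  have c := cvg_std_normal_pdf_invX R.
  have c3 : (fun _ : R => 3 : R) x @[x --> +oo] --> (3 : R) by exact: cvg_cst.
  have cI := cvgD (cvgB (c 0%N) (c 2%N)) (cvgM c3 (c 4%N)).
  rewrite mulr0 subr0 addr0 in cI.
  exact: (integral_itvcy_decay _ _ _ _ f0 cf dI (cI _ _ _)).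
apply: ge0_le_integral => //=.
- by move=> t _; rewrite lee_fin normal_pdf_ge0.
- apply/measurable_EFinP; apply: measurable_funTS; exact: measurable_normal_pdf.
- apply/measurable_EFinP; exact: subspace_continuous_measurable_fun.
- by move=> t; rewrite in_itv/= andbT lee_fin => /f1.
Qed.

(** * The quantile function inverts the distribution function *)

(** The Lipschitz constant is the maximum of the density. *)
Lemma std_normal_cdf_lipschitz (R : realType) (x y : R) : x <= y ->
  0 <= std_normal_cdf y - std_normal_cdf x <= normal_peak 1 * (y - x).
Proof.
move=> xy.
have E : ((std_normal_cdf y - std_normal_cdf x)%:E =
    normal_prob (0 : R) 1 `]x, y])%E.
  rewrite EFinB /std_normal_cdf !fineK; [|exact: fin_num_measure..].
  have -> : normal_prob 0 1 `]-oo, y] =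
      (normal_prob (0 : R) 1 `]-oo, x] + normal_prob (0 : R) 1 `]x, y])%E.
    rewrite (@itv_bndbnd_setU _ _ -oo%O (BRight x) (BRight y))//.
    apply: measureU => //; apply/seteqP; split => // z [/=].
    by rewrite !in_itv/= => zx /andP[xz _]; move: xz; rewrite ltNge zx.
  by rewrite addeAC subee ?add0e//; exact: fin_num_measure.
rewrite -!lee_fin E measure_ge0/= /normal_prob.
apply: (@le_trans _ _ (\int[lebesgue_measure]_(t in `]x, y]) (normal_peak 1)%:E)%E).
  apply: ge0_le_integral => //=.
  - by move=> t _; rewrite lee_fin normal_pdf_ge0.
  - apply/measurable_EFinP; apply: measurable_funTS; exact: measurable_normal_pdf.
  - by move=> t _; rewrite lee_fin normal_pdf_ub// oner_neq0.
rewrite integral_cst//= lebesgue_measure_itv/= lte_fin.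
have [_|yx] := ltP x y; first by rewrite -EFinB -EFinM.
by rewrite mule0 lee_fin mulr_ge0 ?subr_ge0// normal_peak_ge0.
Qed.

Lemma std_normal_cdf_nondecreasing (R : realType) :
  {homo @std_normal_cdf R : x y / x <= y}.
Proof. by move=> x y /std_normal_cdf_lipschitz/andP[]; rewrite subr_ge0. Qed.

Lemma continuous_std_normal_cdf (R : realType) : continuous (@std_normal_cdf R).
Proof.
have p0 : 0 < normal_peak (1 : R) by rewrite normal_peak_gt0// oner_neq0.
move=> x; apply/cvgrPdist_le => e e0; near=> y.
have h : `|x - y| <= e / normal_peak 1.
  near: y; apply: cvgr_dist_le; [exact: cvg_id|exact: divr_gt0].
rewrite ler_pdivlMr// mulrC in h; apply: le_trans h.
have [xy|/ltW yx] := leP x y.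
  have /andP[h1 h2] := std_normal_cdf_lipschitz _ _ _ xy.
  by rewrite distrC (distrC x) ger0_norm// ger0_norm// subr_ge0.
have /andP[h1 h2] := std_normal_cdf_lipschitz _ _ _ yx.
by rewrite ger0_norm// ger0_norm// subr_ge0.
Unshelve. all: by end_near. Qed.

Lemma std_normal_quantileK (R : realType) (p : R) : 0 < p < 1 ->
  std_normal_cdf (std_normal_quantile p) = p.
Proof.
move=> /andP[p0 p1].
(* The identity is a random variable with the normal law, so the limits of
   cumulative distribution functions at infinity apply to Phi. *)
pose mid := isMeasurableFun.Build _ _ (measurableTypeR R) R idfun
  (@measurable_id _ (measurableTypeR R) setT).
pose X : {RV (normal_prob (0 : R) 1) >-> R} := HB.pack (@idfun R) mid.
have Phi1 : @std_normal_cdf R x @[x --> +oo] --> (1 : R).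
  exact: (fine_cvg (cvg_cdfy1 X)).
have Phi0 : @std_normal_cdf R x @[x --> -oo] --> (0 : R).
  exact: (fine_cvg (cvg_cdfNy0 X)).
rewrite /std_normal_quantile pinvK// inE.
have [a [a0 ap]] : exists a : R, a <= 0 /\ std_normal_cdf a <= p.
  near (ninfty_nbhs R) => a; exists a; split; near: a.
    by apply: nbhs_ninfty_le; rewrite num_real.
  by move/cvgr_le : Phi0; apply.
have [b [b0 pb]] : exists b : R, 0 <= b /\ p <= std_normal_cdf b.
  near (pinfty_nbhs R) => b; exists b; split; near: b.
    by apply: nbhs_pinfty_ge; rewrite num_real.
  by move/cvgr_ge : Phi1; apply.
have [c _ <-] : exists2 c, c \in `[a, b] & std_normal_cdf c = p.
  apply: IVT; first exact: le_trans b0.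
    exact/continuous_subspaceT/continuous_std_normal_cdf.
  by rewrite ge_min ap le_max pb orbT.
by exists c.
Unshelve. all: by end_near. Qed.

(** * Asymptotics of the normal quantiles *)

(** If w is the ratio of the tail q to its first-order approximation phi(b)/b,
then -2 ln q = b^2 + ln (b^2) + ln (2 pi) - 2 ln w, and by the Mills bounds w is
1 - b^-2 up to 3 b^-4, so -2 ln w is 2 b^-2 up to a multiple of b^-4. *)
Lemma ln_std_normal_ccdf (R : realType) (b q : R) : 4 <= b ->
  1 - std_normal_cdf b = q ->
  exists2 e, `|e| <= 6 / (b ^+ 2) ^+ 2 &
    b ^+ 2 + ln (b ^+ 2) + 2 / b ^+ 2 + e = ln (q^-1 ^+ 2 / (2 * pi)).
Proof.
move=> b4 qE.
have b0 : 0 < b by lra.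
have phi0 := @std_normal_pdf_gt0 R b.
have tp0 : 0 < 2 * pi :> R by rewrite mulr_gt0// pi_gt0.
have s0 : 0 < Num.sqrt (2 * pi) :> R by rewrite sqrtr_gt0.
have lo : normal_pdf 0 1 b * (b^-1 - b^-1 ^+ 3) <= q.
  by rewrite -qE std_normal_ccdf_ge//; lra.
have hi : q <= normal_pdf 0 1 b * (b^-1 - b^-1 ^+ 3 + 3 * b^-1 ^+ 5).
  by rewrite -qE std_normal_ccdf_le.
set phi := normal_pdf 0 1 b in phi0 lo hi.
set i := (b ^+ 2)^-1.
have i0 : 0 < i by rewrite invr_gt0 exprn_gt0.
have i16 : 16 * i <= 1 by rewrite ler_pdivrMr ?exprn_gt0// mul1r; nra.
pose w := q * b / phi.
have qw : q = phi * b^-1 * w by rewrite /w; field; rewrite !gt_eqF.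
have w1 : 1 - i <= w.
  rewrite /w ler_pdivlMr// -ler_pdivrMr//; apply: le_trans lo.
  by rewrite le_eqVlt; apply/orP; left; apply/eqP; rewrite /i; field; rewrite gt_eqF.
have w2 : w <= 1 - i + 3 * i ^+ 2.
  rewrite /w ler_pdivrMr// -ler_pdivlMr//; apply: (le_trans hi).
  by rewrite le_eqVlt; apply/orP; left; apply/eqP; rewrite /i; field; rewrite gt_eqF.
(* Otherwise unification sees through w and splits it as a product. *)
clearbody w.
have w0 : 0 < w by lra.
have lw2 : ln w <= - i + 3 * i ^+ 2 by have := ln_le_subr1 _ _ w0; lra.
have lw1 : - i - 2 * i ^+ 2 <= ln w.
  have /andP[h _] : - i - 2 * i ^+ 2 <= ln (1 - i) <= - i.
    by apply: ln_onemB_bounds; lra.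
  by apply: (le_trans h); rewrite ler_ln ?posrE//; lra.
exists (- 2 * ln w - 2 * i).
  by rewrite -exprVn -/i ler_norml; apply/andP; split; nra.
have q0 : 0 < q by rewrite qw !mulr_gt0 ?invr_gt0.
have lnphi : 2 * ln phi = - ln (2 * pi) - b ^+ 2.
  rewrite /phi std_normal_pdfE [in LHS]lnM ?posrE ?invr_gt0 ?expR_gt0//.
  rewrite lnV ?posrE// expRK -[in RHS](@sqr_sqrtr _ (2 * pi)) ?ltW//.
  by rewrite lnXn//; field.
move: tp0 lnphi; move: (2 * pi) => tp tp0 lnphi.
rewrite ln_div ?posrE ?exprn_gt0 ?invr_gt0// !lnXn ?invr_gt0// lnV ?posrE//.
rewrite qw !lnM ?posrE ?mulr_gt0 ?invr_gt0// lnV ?posrE// !mulr2n.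
lra.
Qed.

Lemma sqrtr_dist_le (R : rcfType) (b B : R) : 0 < b -> 0 <= B ->
  `|b - Num.sqrt B| <= `|b ^+ 2 - B| / b.
Proof.
move=> b0 B0; rewrite ler_pdivlMr// -{2}(sqr_sqrtr B0) subr_sqr normrM.
by rewrite ler_wpM2l// ger0_norm ?lerDl ?addr_ge0 ?sqrtr_ge0// ltW.
Qed.

Lemma powR_5half (R : realType) (x : R) : 0 < x ->
  x `^ (5 / 2) = x ^+ 2 * Num.sqrt x.
Proof.
move=> x0; have -> : 5 / 2 = 2%:R + 2^-1 :> R by field.
by rewrite powRD ?gt_eqF ?implybT// powR_mulrn ?powR12_sqrt// ltW.
Qed.

(** The two lower bounds on ln n ensure ln n <= L <= 2 ln n and
ln L <= 2 ln (ln n). From 50 to 400 there is a factor 4 for the square of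
ln L <= 2 ln (ln n) and a factor 2 for b_n >= sqrt (ln n) / 2. *)
Lemma b_error_bound (R : realType) (n : nat) : (0 < n)%N ->
  4 <= b_ R n -> std_normal_cdf (b_ R n) = 1 - n%:R^-1 ->
  2 <= ln n%:R :> R -> ln (2 * pi) <= ln n%:R :> R ->
  `|b_ R n - beta_bar R n| <=
    400 * (ln (ln n%:R) ^+ 2 / (ln n%:R `^ (5 / 2))).
Proof.
move=> n0 b4 bn.
have nR0 : 0 < n%:R :> R by rewrite ltr0n.
have tp0 : 0 < 2 * pi :> R by rewrite mulr_gt0// pi_gt0.
have [e e6] : exists2 e, `|e| <= 6 / (b_ R n ^+ 2) ^+ 2 &
    b_ R n ^+ 2 + ln (b_ R n ^+ 2) + 2 / b_ R n ^+ 2 + e =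
    ln (n%:R^-1^-1 ^+ 2 / (2 * pi)).
  by apply: ln_std_normal_ccdf => //; rewrite bn; ring.
rewrite invrK /beta_bar.
set b := b_ R n in b4 bn e6 *; set N := ln n%:R.
set L := ln (n%:R ^+ 2 / (2 * pi)) => eL N2 tpN.
have b0 : 0 < b by lra.
have y16 : 16 <= b ^+ 2 by nra.
have [L16 L2y B0 BE] := ln_equation_expansion _ _ _ _ y16 eL e6.
have LE : L = 2 * N - ln (2 * pi).
  by rewrite /L ln_div ?posrE ?exprn_gt0// lnXn// -/N mulr2n; ring.
have tp1 : 0 <= ln (2 * pi) :> R.
  by apply: ln_ge0; have := pi_ge2 R; lra.
have NL : N <= L by lra.
have LN : L <= 2 * N by lra.
have [L0 N0] : 0 < L /\ 0 < N by split; lra.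
apply: (le_trans (sqrtr_dist_le _ _ _ b0 B0)).
rewrite powR_5half// ler_pdivrMr//; apply: (le_trans BE).
have lL : ln L <= 2 * ln N.
  rewrite mulr_natl mulr2n -lnM ?posrE// ler_ln ?posrE ?mulr_gt0//.
  by apply: (le_trans LN); rewrite ler_pM2r.
have l0 : 0 <= ln L by apply: ln_ge0; lra.
have r0 : 0 < Num.sqrt N by rewrite sqrtr_gt0.
have rb : Num.sqrt N <= 2 * b.
  rewrite -(@ler_pXn2r _ 2)// ?nnegrE; [|exact: ltW|lra].
  by rewrite sqr_sqrtr ?exprMn; lra.
have lLN : ln L / L <= 2 * (ln N / N).
  rewrite mulrA ler_pM ?invr_ge0 ?(ltW L0)// lef_pV2 ?posrE//.
have -> : 400 * (ln N ^+ 2 / (N ^+ 2 * Num.sqrt N)) * b =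
    50 * ((2 * (ln N / N)) ^+ 2 * (2 * b / Num.sqrt N)).
  by field; rewrite !gt_eqF.
rewrite ler_pM2l//; apply: (@le_trans _ _ ((2 * (ln N / N)) ^+ 2)).
  by rewrite ler_pXn2r// nnegrE ?(le_trans _ lLN)// divr_ge0// ltW.
by rewrite ler_peMr ?sqr_ge0// ler_pdivlMr// mul1r.
Qed.

Theorem proposition11 (R : realType) :
  b_ R = beta_bar R +O_\oo
    (fun n : nat => ln (ln n%:R) ^+ 2 / (ln n%:R `^ (5 / 2)) : R).
Proof.
(* As soon as 1/n < 1 - Phi(4), monotonicity of Phi forces b_n >= 4. *)
have c0 : 0 < 1 - std_normal_cdf 4 :> R.
  apply: (@lt_le_trans _ _ (normal_pdf 0 1 4 * (4^-1 - 4^-1 ^+ 3))).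
    by rewrite mulr_gt0 ?std_normal_pdf_gt0//; lra.
  by apply: std_normal_ccdf_ge; lra.
apply/eqaddOP; near=> k; near=> n.
have k400 : 400 <= k by near: k; apply: nbhs_pinfty_ge; rewrite num_real.
have n1 : (1 < n)%N by near: n; exact: nbhs_infty_gt.
have n0 : (0 < n)%N by exact: ltnW.
have nR0 : 0 < n%:R :> R by rewrite ltr0n.
have nc : (1 - std_normal_cdf 4)^-1 < n%:R :> R by near: n; exact: nbhs_infty_gtr.
have ne : expR 2 <= n%:R :> R by near: n; exact: nbhs_infty_ger.
have np : 2 * pi <= n%:R :> R by near: n; exact: nbhs_infty_ger.
have bn : std_normal_cdf (b_ R n) = 1 - n%:R^-1.
  apply: std_normal_quantileK; rewrite subr_gt0 invf_lt1// ltr1n n1/=.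
  by rewrite ltrBlDr ltrDl invr_gt0.
have b4 : 4 <= b_ R n.
  rewrite leNgt; apply/negP => /ltW/std_normal_cdf_nondecreasing.
  apply/negP; rewrite -ltNge bn ltrBrDl -ltrBrDr.
  by rewrite -[ltRHS]invrK ltf_pV2 ?posrE ?invr_gt0.
have N2 : 2 <= ln n%:R :> R by rewrite -(expRK 2) ler_ln ?posrE ?expR_gt0.
have tpN : ln (2 * pi) <= ln n%:R :> R.
  by rewrite ler_ln ?posrE// mulr_gt0// pi_gt0.
apply: (le_trans (b_error_bound _ _ n0 b4 bn N2 tpN)).
rewrite [leRHS]mulrC [X in _ <= X * _]ger0_norm.
  by rewrite mulrC ler_wpM2l// mulr_ge0 ?sqr_ge0 ?invr_ge0 ?powR_ge0.
by rewrite mulr_ge0 ?sqr_ge0 ?invr_ge0 ?powR_ge0.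
Unshelve. all: by end_near. Qed.
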